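(* The function $\sigma:(0,\infty)\to\mathbb{R}$ defined by $$\sigma(x)=12x\ln\frac{\Gamma(x+1)}{\sqrt{2\pi x}\,(x/e)^{x}},\qquad x>0,$$ is strictly increasing on $(0,\infty)$.
   Context: $\Gamma$ denotes the Euler gamma function and $\ln$ the natural logarithm. The function $\sigma$ is the remainder in Stirling's formula, i.e. it is determined by $\Gamma(x+1)=\sqrt{2\pi x}\,(x/e)^{x}e^{\sigma(x)/(12x)}$ for $x>0$. *)

(* Defs.v *)
From mathcomp Require Import all_boot all_order all_algebra.
From mathcomp Require Import all_classical all_reals all_analysis.

Set Implicit Arguments.
Unset Strict Implicit.
Unset Printing Implicit Defensive.

Import Order.TTheory GRing.Theory Num.Theory.
Import numFieldNormedType.Exports.

Local Open Scope ring_scope.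

(* Euler's integral, meaningful for 0 < z only: Rintegral takes
   [fine] of the Lebesgue integral, hence is 0 where the integral diverges. *)
Definition Gamma {R : realType} (z : R) : R :=
  \int[@lebesgue_measure R]_(t in `]0, +oo[) (t `^ (z - 1) * expR (- t)).

(* Only the values at x > 0 are meaningful. *)
Definition sigma {R : realType} (x : R) : R :=
  12 * x * ln (Gamma (x + 1) / (Num.sqrt (2 * pi * x) * (x / expR 1) `^ x)).

(* Main.v *)
Require Import Defs.
From mathcomp Require Import all_boot all_order all_algebra.
From mathcomp Require Import all_classical all_reals all_analysis.
From mathcomp Require Import measurable_realfun.
From mathcomp Require Import ring lra.

Import Order.TTheory GRing.Theory Num.Theory.
Import numFieldNormedType.Exports.

Local Open Scope ring_scope.

(** Write [sigma x = 12 * x * binet x], where [binet] is the logarithm of the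
quotient of [Gamma (x + 1)] by its Stirling approximation. The functional
equation of [Gamma] gives
[[
  binet x - binet (x + 1) = gudermann x = (x + 1/2) ln (1 + 1/x) - 1,
]]
an elementary function. The idea is to compare [sigma] at two points [x < y]
through the sequence [D n = sigma (y + n) - sigma (x + n)].

In the second difference [sigma x - 2 sigma (x + 1) + sigma (x + 2)] all values
of [binet] cancel, and what remains is
[12 (x * gudermann x - (x + 2) * gudermann (x + 1))]. This elementary function
is strictly increasing ([gudermann_diff_lt]): with [p = 1 / (x + 1)], the sign
of its derivative reduces to the inequality
[ln (1 + p) - ln (1 - p) < 2 p + 2/3 p^3 / (1 - p^2)]. Hence the second
differences of [D] are positive. A strictly convex sequence that tends to [0]
is positive ([strictly_convex_seq_gt0]), so [D 0 > 0] as soon as [D] tends to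
[0].

That [D] tends to [0] follows from [sigma (x + n) --> 1] ([cvg_sigma]). As
[gudermann] lies between two telescoping differences, which are
[1 / (12 z) - 1 / (12 (z + 1))] at [z = x] above and at [z = x + 1/2] below,
summation squeezes [binet x] between [1 / (12 (x + 1/2))] and [1 / (12 x)],
provided that [binet (x + n)] tends to [0]. This last fact is the formula of
Stirling with its constant ([cvg_stirling_ratio]). It is proved by the method of
Laplace: in the integral of [t^x e^-t] one substitutes
[t = x + sqrt (2 x) u]; the integrand divided by its maximum [(x / e)^x] then
converges to [e^(-u^2)] and is dominated by [e^(1/4 - |u|/2)], so that dominated
convergence and the Gaussian integral give the limit [sqrt pi]. *)

(** * Logarithmic inequalities *)

Section Calculus.
Context {R : realType}.
Implicit Types (f df : R -> R) (a b t v x y z : R).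

Lemma is_derive_lt f df {a b} : a < b ->
  {in `[a, b], forall x, is_derive x 1 f (df x)} ->
  {in `]a, b[, forall x, 0 < df x} -> f a < f b.
Proof.
move=> ab fdf df0.
have [||c cab] := @MVT R f df a b ab.
- by move=> x xab; apply: fdf; apply: subset_itv_oo_cc xab.
- by apply: derivable_within_continuous => x /fdf [].
by move=> fE; rewrite -subr_gt0 fE mulr_gt0 ?df0 ?subr_gt0.
Qed.

Lemma is_derive_le f df {a b} : a <= b ->
  {in `[a, b], forall x, is_derive x 1 f (df x)} ->
  {in `]a, b[, forall x, 0 <= df x} -> f a <= f b.
Proof.
rewrite le_eqVlt => /predU1P[->//|ab] fdf df0.
have [||c cab] := @MVT R f df a b ab.
- by move=> x xab; apply: fdf; apply: subset_itv_oo_cc xab.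
- by apply: derivable_within_continuous => x /fdf [].
by move=> fE; rewrite -subr_ge0 fE mulr_ge0 ?df0 ?subr_ge0// ltW.
Qed.

Lemma is_derive_ln_comp f {dfx x : R} : 0 < f x ->
  is_derive x 1 f dfx -> is_derive x 1 (fun t => ln (f t)) (dfx / f x).
Proof.
move=> fx0 fdf.
rewrite mulrC; have ? := is_derive1_ln fx0.
exact: is_derive1_comp.
Qed.

Lemma is_derive_ln1D {z} : -1 < z ->
  is_derive z 1 (fun v => ln (1 + v)) (1 + z)^-1.
Proof.
move=> z1.
have d1D : is_derive z 1 (fun v : R => 1 + v) 1.
  by rewrite -[X in is_derive _ _ _ X]add0r; exact: is_deriveD.
have z10 : 0 < 1 + z by rewrite -ltrBlDl sub0r.
by have := is_derive_ln_comp _ z10 d1D; rewrite div1r.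
Qed.

Lemma is_derive_ln1B {z} : z < 1 ->
  is_derive z 1 (fun v => ln (1 - v)) (- (1 - z)^-1).
Proof.
move=> z1.
have d1B : is_derive z 1 (fun v : R => 1 - v) (-1).
  by rewrite -[X in is_derive _ _ _ X]add0r; exact: is_deriveB.
have z10 : 0 < 1 - z by rewrite subr_gt0.
by have := is_derive_ln_comp (fun v => 1 - v) z10 d1B; rewrite mulN1r.
Qed.

(** The two second-order bounds on [ln (1 + v)] come from the monotonicity of
these functions for [v > -1], as both vanish at [0]. The upper one is
multiplied by [2 (1 + v)], which turns its derivative into the nonnegative
[2 (v - ln (1 + v))]. *)
Let ln1D_lo (v : R) := ln (1 + v) - (v - v ^+ 2 / 2).
Let ln1D_up (v : R) := v ^+ 2 + 2 * v - 2 * (1 + v) * ln (1 + v).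

Let is_derive_ln1D_lo z : -1 < z ->
  is_derive z 1 ln1D_lo (z ^+ 2 / (1 + z)).
Proof.
move=> z1; have ? := is_derive_ln1D z1.
apply: is_derive_eq; rewrite /GRing.scale/=.
by field; rewrite gt_eqF// -ltrBlDl sub0r.
Qed.

Let is_derive_ln1D_up z : -1 < z ->
  is_derive z 1 ln1D_up (2 * (z - ln (1 + z))).
Proof.
move=> z1; have ? := is_derive_ln1D z1.
apply: is_derive_eq; rewrite /GRing.scale/=.
by field; rewrite gt_eqF// -ltrBlDl sub0r.
Qed.

Let ln1D_lo_le {a b} : -1 < a -> a <= b -> ln1D_lo a <= ln1D_lo b.
Proof.
move=> a1 ab; apply: (is_derive_le _ (fun z => z ^+ 2 / (1 + z)) ab) => z.
  by rewrite in_itv/= => /andP[az _]; apply: is_derive_ln1D_lo; lra.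
by rewrite in_itv/= => /andP[az _]; rewrite divr_ge0 ?sqr_ge0//; lra.
Qed.

Let ln1D_up_le {a b} : -1 < a -> a <= b -> ln1D_up a <= ln1D_up b.
Proof.
move=> a1 ab; apply: (is_derive_le _ (fun z => 2 * (z - ln (1 + z))) ab) => z.
  by rewrite in_itv/= => /andP[az _]; apply: is_derive_ln1D_up; lra.
rewrite in_itv/= => /andP[az _].
by rewrite mulr_ge0// subr_ge0 le_ln1Dx//; lra.
Qed.

(** Both bounds agree with [ln (1 + v)] up to the second order; in the method of
Laplace they yield at once the pointwise limit and the domination. *)
Lemma ln1D_ge0_bounds {v} : 0 <= v ->
  v - v ^+ 2 / 2 <= ln (1 + v) <= v - v ^+ 2 / (2 * (1 + v)).
Proof.
move=> v0; have v10 : 0 < 1 + v by lra.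
have := ln1D_lo_le (ltrN10 _) v0; have := ln1D_up_le (ltrN10 _) v0.
rewrite /ln1D_up /ln1D_lo !addr0 ln1 !(expr0n, mulr0, mul0r, subr0)/= => up lo.
apply/andP; split; first by lra.
have -> : v - v ^+ 2 / (2 * (1 + v)) = (v ^+ 2 + 2 * v) / (2 * (1 + v)).
  by field; rewrite gt_eqF.
by rewrite ler_pdivlMr; lra.
Qed.

Lemma ln1D_le0_bounds {v} : -1 < v <= 0 ->
  v - v ^+ 2 / (2 * (1 + v)) <= ln (1 + v) <= v - v ^+ 2 / 2.
Proof.
move=> /andP[v1 v0]; have v10 : 0 < 1 + v by lra.
have := ln1D_lo_le v1 v0; have := ln1D_up_le v1 v0.
rewrite /ln1D_up /ln1D_lo !addr0 ln1 !(expr0n, mulr0, mul0r, subr0)/= => up lo.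
apply/andP; split; last by lra.
have -> : v - v ^+ 2 / (2 * (1 + v)) = (v ^+ 2 + 2 * v) / (2 * (1 + v)).
  by field; rewrite gt_eqF.
by rewrite ler_pdivrMr; lra.
Qed.

(** The left-hand side consists of the first two terms of the series
[2 (t + t^3/3 + t^5/5 + ...)] of [ln ((1 + t) / (1 - t))]. *)
Lemma ln_ratio_ge {t} : 0 <= t < 1 ->
  2 * t + 2 / 3 * t ^+ 3 <= ln (1 + t) - ln (1 - t).
Proof.
move=> /andP[t0 t1].
pose f (z : R) := ln (1 + z) - ln (1 - z) - (2 * z + 2 / 3 * z ^+ 3).
have : f 0 <= f t.
  apply: (is_derive_le _ (fun z => 2 * z ^+ 4 / (1 - z ^+ 2)) t0) => z;
    rewrite in_itv/= => /andP[z0 zt].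
    have zN1 : -1 < z by lra.
    have z1 : z < 1 by lra.
    have ? := is_derive_ln1D zN1; have ? := is_derive_ln1B z1.
    apply: is_derive_eq; rewrite /GRing.scale/=.
    have z10 : 1 - z != 0 by rewrite gt_eqF// subr_gt0.
    have z20 : 1 + z != 0 by rewrite gt_eqF//; lra.
    have -> : 1 - z ^+ 2 = (1 - z) * (1 + z) by ring.
    by field; rewrite z10 z20.
  by rewrite divr_ge0 ?mulr_ge0 ?exprn_ge0 ?(ltW z0)//; nra.
by rewrite /f !(addr0, subr0) ln1 !expr0n/=; lra.
Qed.

(** In the series [2 (t + t^3/3 + t^5/5 + ...)] every term from the second on is
at most the corresponding term of the geometric series
[2/3 t^3 / (1 - t^2)]. With the denominator cleared, the difference of both
sides has derivative [2 t (ln (1 + t) - ln (1 - t) - 2 t)], positive by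
[ln_ratio_ge]. The same inequality bounds [gudermann] from above and gives the
sign of the derivative in [convexity_kernel_gt0]. *)
Lemma ln_ratio_lt {t} : 0 < t < 1 ->
  (ln (1 + t) - ln (1 - t) - 2 * t) * (1 - t ^+ 2) < 2 / 3 * t ^+ 3.
Proof.
move=> /andP[t0 t1].
pose f (z : R) :=
  2 / 3 * z ^+ 3 - (ln (1 + z) - ln (1 - z) - 2 * z) * (1 - z ^+ 2).
have : f 0 < f t.
  apply: (is_derive_lt _ (fun z => 2 * z * (ln (1 + z) - ln (1 - z) - 2 * z))
            t0) => z; rewrite in_itv/= => /andP[z0 zt].
    have zN1 : -1 < z by lra.
    have z1 : z < 1 by lra.
    have ? := is_derive_ln1D zN1; have ? := is_derive_ln1B z1.
    apply: is_derive_eq; rewrite /GRing.scale/=.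
    have z10 : 1 - z != 0 by rewrite gt_eqF// subr_gt0.
    have z20 : 1 + z != 0 by rewrite gt_eqF//; lra.
    by field; rewrite z10 z20.
  rewrite mulr_gt0 ?mulr_gt0// subr_gt0.
  have z01 : 0 <= z < 1 by lra.
  apply: lt_le_trans (ln_ratio_ge z01).
  by rewrite ltrDl mulr_gt0// exprn_gt0.
by rewrite /f !(addr0, subr0) ln1 !expr0n/=; lra.
Qed.

(** At [p = 1 / (x + 1)] this is [p] times the derivative at [x] of the function
of [gudermann_diff_lt]. It vanishes at [0], and the numerator of its own
derivative is [3/2] times the gap in [ln_ratio_lt]. *)
Let convexity_kernel_gt0 {p : R} : 0 < p < 1 ->
  0 < p ^+ 2 - (2 - 3 / 2 * p) * ln (1 - p) - (2 + 3 / 2 * p) * ln (1 + p).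
Proof.
move=> /andP[p0 p1].
pose f (z : R) :=
  z ^+ 2 - (2 - 3 / 2 * z) * ln (1 - z) - (2 + 3 / 2 * z) * ln (1 + z).
pose df (z : R) := (z ^+ 3 - 3 / 2 *
  ((ln (1 + z) - ln (1 - z) - 2 * z) * (1 - z ^+ 2))) / ((1 - z) * (1 + z)).
have : f 0 < f p.
  apply: (is_derive_lt _ df p0) => z; rewrite in_itv/= => /andP[z0 zt].
    have zN1 : -1 < z by lra.
    have z1 : z < 1 by lra.
    have ? := is_derive_ln1D zN1; have ? := is_derive_ln1B z1.
    apply: is_derive_eq; rewrite /df /GRing.scale/=.
    have z10 : 1 - z != 0 by rewrite gt_eqF// subr_gt0.
    have z20 : 1 + z != 0 by rewrite gt_eqF//; lra.
    by field; rewrite z10 z20.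
  have z01 : 0 < z < 1 by lra.
  have := ln_ratio_lt z01 => lt_z.
  by rewrite divr_gt0 ?mulr_gt0//; lra.
by rewrite /f !(addr0, subr0) ln1 !expr0n/=; lra.
Qed.

(** The general term of the series of Gudermann, whose sum over
[x, x + 1, x + 2, ...] is the logarithm of the Stirling quotient at [x]. *)
Definition gudermann x := (x + 1 / 2) * (ln (x + 1) - ln x) - 1.

(** Centring [x] and [x + 1] at [x + 1/2] makes the expansion of
[ln (x + 1) - ln x] odd, hence accurate enough for [gudermann_bounds]. *)
Lemma ln_ratioE {x} : 0 < x ->
  let t := (2 * x + 1)^-1 in ln (x + 1) - ln x = ln (1 + t) - ln (1 - t).
Proof.
move=> x0 t; have x20 : 2 * x + 1 != 0 by rewrite gt_eqF//; lra.
have -> : 1 + t = 2 / (2 * x + 1) * (x + 1) by rewrite /t; field.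
have -> : 1 - t = 2 / (2 * x + 1) * x by rewrite /t; field.
have c0 : 0 < 2 / (2 * x + 1) by rewrite divr_gt0//; lra.
by rewrite !lnM ?posrE//; lra.
Qed.

(** With [t = 1 / (2 x + 1)] one has [x + 1/2 = 1 / (2 t)], and the bounds on
[ln ((1 + t) / (1 - t))] become
[t^2 / 3 <= gudermann x <= t^2 / (3 (1 - t^2))]. The upper value is exactly the
difference of [1 / (12 x)]; the lower one exceeds the difference of
[1 / (12 (x + 1/2))]. *)
Lemma gudermann_bounds {x} : 0 < x ->
  (12 * (x + 1 / 2))^-1 - (12 * (x + 3 / 2))^-1 <= gudermann x <=
  (12 * x)^-1 - (12 * (x + 1))^-1.
Proof.
move=> x0; rewrite /gudermann ln_ratioE//; set t := (2 * x + 1)^-1.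
have x20 : 2 * x + 1 != 0 by rewrite gt_eqF//; lra.
have t0 : 0 < t by rewrite invr_gt0; lra.
have t1 : t < 1 by rewrite invf_lt1; lra.
have t01 : 0 <= t < 1 by rewrite ltW.
have t01' : 0 < t < 1 by rewrite t0.
have xE : x + 1 / 2 = (2 * t)^-1 by rewrite /t; field.
have lo := ln_ratio_ge t01.
have up := ln_ratio_lt t01'.
set L := ln _ - ln _ in lo up *.
apply/andP; split.
  apply: (@le_trans _ _ (t ^+ 2 / 3)).
    have -> : (12 * (x + 1 / 2))^-1 - (12 * (x + 3 / 2))^-1 =
              (t ^+ 2 / 3) * (1 - (2 * x + 3)^-1 * 2).
      by rewrite /t; field; rewrite !gt_eqF//; lra.
    have : 0 <= (2 * x + 3)^-1 * 2 by rewrite mulr_ge0// invr_ge0; lra.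
    by move=> c0; apply: ler_piMr; [rewrite divr_ge0 ?sqr_ge0|lra].
  have -> : t ^+ 2 / 3 = (x + 1 / 2) * (2 * t + 2 / 3 * t ^+ 3) - 1.
    by rewrite xE; field; rewrite gt_eqF.
  by rewrite lerD2r ler_pM2l//; lra.
have -> : (12 * x)^-1 - (12 * (x + 1))^-1 = t ^+ 2 / (3 * (1 - t ^+ 2)).
  rewrite /t; field; rewrite x20 (gt_eqF x0)/=.
  by apply/andP; split; rewrite gt_eqF//; nra.
have t20 : 0 < 1 - t ^+ 2 by nra.
have -> : (x + 1 / 2) * L - 1 = (x + 1 / 2) * (L - 2 * t).
  by rewrite xE; field; rewrite gt_eqF.
rewrite ler_pdivlMr ?mulr_gt0// xE.
rewrite [leRHS](_ : _ = (2 * t)^-1 * (3 * (2 / 3 * t ^+ 3))); last first.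
  by field; rewrite gt_eqF.
rewrite -(mulrA (2 * t)^-1) ler_pM2l ?invr_gt0 ?mulr_gt0//.
by rewrite mulrCA ler_pM2l// ltW.
Qed.

Lemma gudermann_diff_lt {x y} : 0 < x -> x < y ->
  x * gudermann x - (x + 2) * gudermann (x + 1) <
  y * gudermann y - (y + 2) * gudermann (y + 1).
Proof.
move=> x0 xy.
pose S (z : R) := z * ((z + 1 / 2) * (ln (z + 1) - ln z) - 1) -
  (z + 2) * ((z + 1 + 1 / 2) * (ln (z + 1 + 1) - ln (z + 1)) - 1).
pose p (z : R) := (z + 1)^-1.
pose dS (z : R) := ((p z) ^+ 2 - (2 - 3 / 2 * p z) * ln (1 - p z)
  - (2 + 3 / 2 * p z) * ln (1 + p z)) / p z.
apply: (is_derive_lt S dS xy) => z; rewrite in_itv/= => /andP[xz zy]; last first.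
  have p0 : 0 < p z by rewrite invr_gt0; lra.
  by rewrite divr_gt0// convexity_kernel_gt0// p0/= invf_lt1; lra.
have z0 : 0 < z by lra.
have z10 : 0 < z + 1 by lra.
have z20 : 0 < z + 1 + 1 by lra.
have dln : is_derive z 1 (@ln R) z^-1 by exact: is_derive1_ln.
have dD (a : R) : is_derive z 1 (fun v : R => v + a) 1.
  by rewrite -[X in is_derive _ _ _ X]addr0; exact: is_deriveD.
have dD2 : is_derive z 1 (fun v : R => v + 1 + 1) 1.
  by rewrite -[X in is_derive _ _ _ X]addr0; exact: is_deriveD.
have dln1 := is_derive_ln_comp (fun v => v + 1) z10 (dD 1).
have dln2 := is_derive_ln_comp (fun v => v + 1 + 1) z20 dD2.
apply: is_derive_eq; rewrite /dS /p /GRing.scale/=.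
(* The logarithms of 1 - p and 1 + p unfold to those of z, z + 1 and z + 2. *)
have -> : 1 - (z + 1)^-1 = z / (z + 1) by field; rewrite gt_eqF.
have -> : 1 + (z + 1)^-1 = (z + 1 + 1) / (z + 1) by field; rewrite gt_eqF.
rewrite !ln_div ?posrE//.
by field; rewrite !gt_eqF//; lra.
Qed.

End Calculus.

(** * The Euler integral and its functional equation *)

Section GammaFunction.
Local Open Scope classical_set_scope.
Local Open Scope ring_scope.
Context {R : realType}.
Notation mu := (@lebesgue_measure R).
Implicit Types a x t u z : R.

(** The positive part makes the integrand of [Gamma] continuous on the whole line
and null on the negative half-line, whereas [t `^ a] is [1] for [t < 0]. *)
Definition ppowR a t := Num.max 0 t `^ a.

Lemma ppowR_ge0 a t : 0 <= ppowR a t. Proof. exact: powR_ge0. Qed.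

Lemma ppowR_pos a t : 0 <= t -> ppowR a t = t `^ a.
Proof. by rewrite /ppowR => /max_idPr ->. Qed.

Lemma ppowR_neg a t : a != 0 -> t <= 0 -> ppowR a t = 0.
Proof. by rewrite /ppowR => a0 /max_idPl ->; rewrite powR0. Qed.

Lemma continuous_ppowR {a} : 0 < a -> continuous (ppowR a).
Proof.
move=> a0 t; have [t0|t0|->] := ltgtP t 0.
- rewrite /continuous_at ppowR_neg ?(ltW t0) ?gt_eqF//.
  apply: cvg_near_cst; near=> z; rewrite ppowR_neg ?gt_eqF//.
  by apply: ltW; near: z; exact: lt_nbhsl.
- apply: (@cvg_trans _ (z `^ a @[z --> t])).
    apply: near_eq_cvg; near=> z; rewrite ppowR_pos//.
    by apply: ltW; near: z; exact: lt_nbhsr.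
  rewrite /= ppowR_pos ?ltW//.
  have : derivable (fun z : R => z `^ a) t 1.
    by apply: derivable_powR; rewrite in_itv/= t0.
  by move=> /derivable1_diffP/differentiable_continuous.
- apply/left_right_continuousP; rewrite /= ppowR_neg ?gt_eqF//; split.
    by apply: cvg_near_cst; near=> z; rewrite ppowR_neg ?gt_eqF.
  apply: (@cvg_trans _ (z `^ a @[z --> 0^'+])); last exact: powR_cvg0.
  by apply: near_eq_cvg; near=> z; rewrite ppowR_pos.
Unshelve. all: by end_near. Qed.

Definition gamma_density a t := ppowR a t * expR (- t).

Lemma gamma_density_ge0 a t : 0 <= gamma_density a t.
Proof. by rewrite mulr_ge0 ?ppowR_ge0 ?expR_ge0. Qed.

Lemma continuous_expRN : continuous (fun t : R => expR (- t)).
Proof.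
by move=> t; apply: continuous_comp; [exact: opp_continuous|exact: continuous_expR].
Qed.

Lemma continuous_gamma_density {a} : 0 < a -> continuous (gamma_density a).
Proof.
move=> a0 t; apply: cvgM; [exact: continuous_ppowR|exact: continuous_expRN].
Qed.

Lemma measurable_gamma_density {a} : 0 < a ->
  measurable_fun setT (gamma_density a).
Proof.
by move=> a0; apply: continuous_measurable_fun; exact: continuous_gamma_density.
Qed.

Lemma GammaE {x} : 0 < x ->
  Gamma (x + 1) = fine (\int[mu]_(t in `[0%R, +oo[) (gamma_density x t)%:E)%E.
Proof.
move=> x0; rewrite /Gamma /Rintegral; congr fine.
rewrite -integral_itv_obnd_cbnd; last first.
  by apply/measurable_EFinP/measurable_funTS; exact: measurable_gamma_density.
apply: eq_integral => t; rewrite inE/= in_itv/= andbT => t0.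
by rewrite addrK /gamma_density ppowR_pos// ltW.
Qed.

Lemma GammaET {x} : 0 < x ->
  Gamma (x + 1) = fine (\int[mu]_t (gamma_density x t)%:E)%E.
Proof.
move=> x0; rewrite GammaE//; congr fine.
rewrite -[in RHS](setUv `[0, +oo[%classic) ge0_integral_setU//=.
- rewrite [X in (_ + X)%E]integral0_eq ?adde0//= => t.
  rewrite in_itv/= andbT => /negP; rewrite -ltNge => t0.
  by rewrite /gamma_density ppowR_neg ?mul0r ?gt_eqF ?ltW.
- exact: measurableC.
- by apply/measurable_EFinP/measurable_funTS; exact: measurable_gamma_density.
- by move=> t _; rewrite lee_fin gamma_density_ge0.
- exact/disj_setPCl.
Qed.

(** This is [ln r <= r] for [r = t / (2 a)], multiplied by [a] and
exponentiated. *)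
Lemma powR_le_expR_half {a t} : 0 < a -> 0 < t ->
  t `^ a <= (2 * a) `^ a * expR (t / 2).
Proof.
move=> a0 t0; have c0 : 0 < 2 * a by rewrite mulr_gt0.
rewrite /powR !gt_eqF// -expRD ler_expR.
have : ln (t / (2 * a)) <= t / (2 * a) - 1.
  have := @le_ln1Dx R (t / (2 * a) - 1); rewrite addrCA subrr addr0; apply.
  by rewrite ltrBrDl subrr divr_gt0.
rewrite ln_div ?posrE// lerBlDr => /(ler_wpM2l (ltW a0)) /le_trans; apply.
rewrite mulrDr mulrBr mulr1.
have -> : a * (t / (2 * a)) = t / 2 by field; rewrite gt_eqF.
by lra.
Qed.

Lemma cvg_gamma_density {a} : 0 < a -> gamma_density a n%:R @[n --> \oo] --> 0.
Proof.
move=> a0.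
have h : (2 * a) `^ a * expR (- (1 / 2)) ^+ n @[n --> \oo] --> 0.
  rewrite -(mulr0 ((2 * a) `^ a)); apply: cvgMl_tmp; apply: cvg_expr.
  by rewrite ger0_norm ?expR_ge0// expR_lt1; lra.
apply: squeeze_cvgr h; last exact: cvg_cst.
near=> n; rewrite gamma_density_ge0/= /gamma_density ppowR_pos//.
have n0 : 0 < n%:R :> R by rewrite ltr0n; near: n; exists 1%N.
apply: (le_trans (ler_wpM2r (expR_ge0 _) (powR_le_expR_half a0 n0))).
rewrite -mulrA -expRD -expRM_natl ler_wpM2l ?powR_ge0// ler_expR; lra.
Unshelve. all: by end_near. Qed.

End GammaFunction.

Section Recurrence.
Local Open Scope classical_set_scope.
Local Open Scope ring_scope.
Context {R : realType}.
Notation mu := (@lebesgue_measure R).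
Implicit Types a b x t u z : R.

Lemma is_derive_ppowR {a t} : 0 < t ->
  is_derive t 1 (ppowR (a + 1)) ((a + 1) * ppowR a t).
Proof.
move=> t0; have := is_derive1_powR (a + 1) t0.
rewrite addrK ppowR_pos ?ltW//; apply: near_eq_is_derive => //.
by near=> z; rewrite ppowR_pos//; apply: ltW; near: z; exact: lt_nbhsr.
Unshelve. all: by end_near. Qed.

Lemma integral_gamma_density_by_parts {a b} : 0 < a -> 0 < b ->
  (\int[mu]_(t in `[0%R, b]) (gamma_density (a + 1) t)%:E =
   (a + 1)%:E * \int[mu]_(t in `[0%R, b]) (gamma_density a t)%:E
   - (gamma_density (a + 1) b)%:E)%E.
Proof.
move=> a0 b0; have a10 : 0 < a + 1 by rewrite addr_gt0.
have dG (t : R) : is_derive t 1 (fun s : R => - expR (- s)) (expR (- t)).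
  by apply: is_derive_eq; rewrite /GRing.scale/= mulrN1 opprK.
have cG : continuous (fun s : R => - expR (- s)).
  by move=> t; apply: cvgN; exact: continuous_expRN.
have cp := continuous_ppowR a10.
have cg : continuous (fun t => (a + 1) * ppowR a t).
  by move=> t; apply: cvgMl_tmp; exact: continuous_ppowR.
rewrite /gamma_density
  (@integration_by_parts R (ppowR (a + 1)) (fun s => - expR (- s))
    (fun t => (a + 1) * ppowR a t) (fun s => expR (- s)))//.
- rewrite (@ppowR_neg _ _ 0) ?gt_eqF// mul0r subr0.
  have fGE t : (a + 1) * ppowR a t * - expR (- t) =
      - (a + 1) * gamma_density a t by rewrite /gamma_density; ring.
  under eq_integral => t _ do rewrite fGE EFinM.
  rewrite integralZl//=; last first.
    apply: continuous_compact_integrable; first exact: segment_compact.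
    by apply: continuous_subspaceT; exact: continuous_gamma_density.
  by rewrite EFinN mulNe oppeK addeC mulrN EFinN.
- exact: continuous_subspaceT.
- split => [t| |].
  + by rewrite in_itv/= => /andP[t0 _]; have [] := @is_derive_ppowR a t t0.
  + by apply: cvg_at_right_filter; exact: cp.
  + by apply: cvg_at_left_filter; exact: cp.
- move=> t; rewrite in_itv/= => /andP[t0 _].
  by rewrite derive1E; have [_ ->] := @is_derive_ppowR a t t0.
- by apply: continuous_subspaceT; exact: continuous_expRN.
- split => [t _| |].
  + by have [] := dG t.
  + by apply: cvg_at_right_filter; exact: cG.
  + by apply: cvg_at_left_filter; exact: cG.
- by move=> t _; rewrite derive1E; have [_ ->] := dG t.
Qed.

(** Letting the upper end of the interval tend to infinity in
[integral_gamma_density_by_parts] kills the boundary term. The identity is one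
between extended reals, where the integrals over [0 <= t <= n] of a nonnegative
function always converge. *)
Lemma integral_gamma_density_rec {a} : 0 < a ->
  (\int[mu]_(t in `[0%R, +oo[) (gamma_density (a + 1) t)%:E =
   (a + 1)%:E * \int[mu]_(t in `[0%R, +oo[) (gamma_density a t)%:E)%E.
Proof.
move=> a0; have a10 : 0 < a + 1 by rewrite addr_gt0.
have lim b : 0 < b ->
    (\int[mu]_(t in `[0%R, n%:R]) (gamma_density b t)%:E @[n --> \oo] -->
     \int[mu]_(t in `[0%R, +oo[) (gamma_density b t)%:E)%E.
  move=> b0; apply: ge0_cvgn_integral; first exact: gamma_density_ge0.
  exact: measurable_gamma_density.
have bd : (gamma_density (a + 1) n%:R)%:E @[n --> \oo] --> 0%E.
  by apply: cvg_EFin; [exact: nearW|exact: cvg_gamma_density].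
have rhs := cvgeZl (erefl : (a + 1)%:E \is a fin_num) (lim _ a0).
suff rec : (\int[mu]_(t in `[0%R, n%:R]) (gamma_density (a + 1) t)%:E
    @[n --> \oo] -->
    (a + 1)%:E * \int[mu]_(t in `[0%R, +oo[) (gamma_density a t)%:E)%E.
  exact: (cvg_unique _ (lim _ a10) rec).
rewrite -[X in _ --> X]sube0.
apply: cvg_trans (cvgeB (fin_num_adde_defl _ _) rhs bd) => //.
apply: near_eq_cvg; near=> n.
apply/esym/(integral_gamma_density_by_parts a0); rewrite ltr0n.
by near: n; exists 1%N.
Unshelve. all: by end_near. Qed.

(** As [fine] maps both infinities to [0], it commutes with the multiplication by
a positive real for every extended real. *)
Lemma fine_mulEFin (c : R) (e : \bar R) : 0 < c ->
  fine (c%:E * e)%E = c * fine e.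
Proof.
move=> c0; case: e => [r| |]//=.
- by rewrite gt0_muley ?mulr0 ?lte_fin.
- by rewrite gt0_muleNy ?mulr0 ?lte_fin.
Qed.
Lemma GammaS {x} : 0 < x -> Gamma (x + 1 + 1) = (x + 1) * Gamma (x + 1) :> R.
Proof.
move=> x0; rewrite !GammaE ?addr_gt0//.
by rewrite integral_gamma_density_rec// fine_mulEFin// addr_gt0.
Qed.

End Recurrence.

(** * The formula of Stirling by the method of Laplace *)

Section Stirling.
Local Open Scope classical_set_scope.
Local Open Scope ring_scope.
Context {R : realType}.
Notation mu := (@lebesgue_measure R).
Implicit Types a b x t u z : R.

(** The width of the peak of [t^x e^-t] at its maximum [t = x]; the factor [2]
makes the limit [e^(-u^2)] rather than [e^(-u^2/2)]. *)
Let spread x : R := Num.sqrt (2 * x).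

Let spread_gt0 {x} : 0 < x -> 0 < spread x.
Proof. by move=> x0; rewrite sqrtr_gt0 mulr_gt0. Qed.

Let spread_sqr {x} : 0 < x -> x = spread x ^+ 2 / 2.
Proof. by move=> x0; rewrite sqr_sqrtr ?mulr_ge0 1?ltW//; field. Qed.

(** The integrand of [Gamma (x + 1)] centred at its maximum, rescaled by
[spread x] and divided by its maximal value. *)
Let peak_kernel x u := gamma_density x (x + spread x * u) / gamma_density x x.

Let gamma_density_peak_gt0 {x} : 0 < x -> 0 < gamma_density x x.
Proof.
move=> x0; rewrite mulr_gt0 ?expR_gt0// ppowR_pos ?powR_gt0//; exact: ltW.
Qed.

Let peak_kernel_ge0 x u : 0 <= peak_kernel x u.
Proof. by rewrite divr_ge0 ?gamma_density_ge0. Qed.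

Let continuous_affine x : continuous (fun u => x + spread x * u).
Proof.
by move=> u; apply: cvgD; [exact: cvg_cst|apply: cvgMl_tmp; exact: cvg_id].
Qed.

Let continuous_peak_kernel {x} : 0 < x -> continuous (peak_kernel x).
Proof.
move=> x0 u; apply: cvgMr_tmp.
apply: (@continuous_comp _ _ _ (fun u => x + spread x * u)).
  exact: continuous_affine.
exact: continuous_gamma_density.
Qed.

(** Substitution [t = x + spread x * u]. *)
Let integral_gamma_density_kernel {x} : 0 < x ->
  (\int[mu]_t (gamma_density x t)%:E =
   (spread x * gamma_density x x)%:E * \int[mu]_u (peak_kernel x u)%:E)%E.
Proof.
move=> x0; have s0 := spread_gt0 x0; have p0 := gamma_density_peak_gt0 x0.
pose F u := x + spread x * u.
have FE : F = (fun r => r + x) \o (fun u => u * spread x).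
  by apply/funext => u; rewrite /F /= addrC mulrC.
have dF u : is_derive u 1 F (spread x).
  by apply: is_derive_eq; rewrite /GRing.scale/=; ring.
have F'E : F^`()%classic = cst (spread x).
  by apply/funext => u; rewrite derive1E; have [_ ->] := dF u.
rewrite (@increasing_ge0_integration_by_substitutionT _ F).
- rewrite -ge0_integralZl//=.
  + apply: eq_integral => u _; rewrite -EFinM; congr EFin.
    rewrite F'E !fctE/= /peak_kernel -/(F u).
    by field; rewrite gt_eqF.
  + apply/measurable_EFinP; apply: continuous_measurable_fun.
    exact: continuous_peak_kernel.
  + by move=> u _; rewrite lee_fin peak_kernel_ge0.
  + by rewrite lee_fin mulr_ge0 ?ltW.
- by move=> u v uv; rewrite /F ltrD2l ltr_pM2l.
- by rewrite F'E => ?; exact: cvg_cst.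
- by rewrite F'E; exact: is_cvg_cst.
- by rewrite F'E; exact: is_cvg_cst.
- by move=> u; have [] := dF u.
- rewrite FE; apply: cvg_comp (cvg_addrr_Ny x).
  by apply: gt0_cvgMlNy => //; exact: cvg_id.
- rewrite FE; apply: cvg_comp (cvg_addrr x).
  by apply: gt0_cvgMly => //; exact: cvg_id.
- exact: continuous_gamma_density.
- exact: gamma_density_ge0.
Qed.

Let affineE {x} u : 0 < x ->
  x + spread x * u = x * (1 + 2 * u / spread x).
Proof.
move=> x0; have s0 := spread_gt0 x0.
by rewrite {1 3}(spread_sqr x0); field; rewrite gt_eqF.
Qed.

Let peak_kernel_expR {x u} : 0 < x -> 0 < 1 + 2 * u / spread x ->
  peak_kernel x u =
  expR (x * (ln (1 + 2 * u / spread x) - 2 * u / spread x)).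
Proof.
move=> x0 v0; have FE := affineE u x0.
have F0 : 0 < x + spread x * u by rewrite FE mulr_gt0.
rewrite /peak_kernel /gamma_density !ppowR_pos ?ltW// /powR !gt_eqF//.
rewrite -!expRD -expRB {1}FE lnM ?posrE//; congr expR.
rewrite FE.
set L := ln (1 + _).
set L' := ln x.
ring.
Qed.

Let peak_kernel_eq0 {x u} : 0 < x -> 1 + 2 * u / spread x <= 0 ->
  peak_kernel x u = 0.
Proof.
move=> x0 v0.
have F0 : x + spread x * u <= 0 by rewrite affineE// pmulr_rle0.
by rewrite /peak_kernel /gamma_density ppowR_neg ?gt_eqF// !mul0r.
Qed.

(** The second-order bounds on [ln (1 + v)], at [v = 2 u / s] and multiplied by
[x = s^2 / 2]: the quadratic term [x v^2 / 2] is [u^2], independently of [x]. *)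
Let kernel_exponent x u s : s != 0 -> 1 + 2 * u / s != 0 -> x = s ^+ 2 / 2 ->
  (x * (2 * u / s - (2 * u / s) ^+ 2 / 2) = x * (2 * u / s) - u ^+ 2) *
  (x * (2 * u / s - (2 * u / s) ^+ 2 / (2 * (1 + 2 * u / s))) =
   x * (2 * u / s) - u ^+ 2 / (1 + 2 * u / s)).
Proof.
move=> s0 v0 ->; have sv0 : s + 2 * u != 0.
  have vE : 1 + 2 * u / s = (s + 2 * u) / s by field.
  by move: v0; rewrite vE mulf_eq0 => /norP[].
by split; field => //; rewrite s0.
Qed.

Let peak_kernel_ge0_bounds {x u} : 0 < x -> 0 <= u ->
  expR (- u ^+ 2) <= peak_kernel x u <=
  expR (- (u ^+ 2 / (1 + 2 * u / spread x))).
Proof.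
move=> x0 u0; have s0 := spread_gt0 x0.
have v0 : 0 <= 2 * u / spread x by rewrite divr_ge0 ?mulr_ge0// ltW.
have v10 : 0 < 1 + 2 * u / spread x by lra.
rewrite peak_kernel_expR// !ler_expR.
have /andP[/(ler_wpM2l (ltW x0)) lo /(ler_wpM2l (ltW x0)) up] :=
  ln1D_ge0_bounds v0.
rewrite mulrBr; move: lo up; set L := ln _.
have [-> ->] := kernel_exponent _ u _ (lt0r_neq0 s0) (lt0r_neq0 v10)
  (spread_sqr x0).
by move=> lo up; apply/andP; split; lra.
Qed.

Let peak_kernel_le0_bounds {x u} : 0 < x -> u <= 0 ->
  0 < 1 + 2 * u / spread x ->
  expR (- (u ^+ 2 / (1 + 2 * u / spread x))) <= peak_kernel x u <=
  expR (- u ^+ 2).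
Proof.
move=> x0 u0 v10; have s0 := spread_gt0 x0.
have v0 : -1 < 2 * u / spread x <= 0.
  apply/andP; split; first by lra.
  by rewrite mulr_le0_ge0 ?invr_ge0 ?(ltW s0)//; lra.
rewrite peak_kernel_expR// !ler_expR.
have /andP[/(ler_wpM2l (ltW x0)) lo /(ler_wpM2l (ltW x0)) up] :=
  ln1D_le0_bounds v0.
rewrite mulrBr; move: lo up; set L := ln _.
have [-> ->] := kernel_exponent _ u _ (lt0r_neq0 s0) (lt0r_neq0 v10)
  (spread_sqr x0).
by move=> lo up; apply/andP; split; lra.
Qed.

(** For [u >= 0] and [spread x >= 1] the kernel is at most
[e^(-u^2 / (1 + 2 u))], and [u^2 / (1 + 2 u) >= u/2 - 1/4] because
[(2 u + 1) (u/2 - 1/4) = u^2 - 1/4]. For [u <= 0] it is at most [e^(-u^2)], and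
[u^2 >= |u|/2 - 1/4]. *)
Let dominator u : R := expR (1 / 4 - `|u| / 2).

Let continuous_dominator : continuous dominator.
Proof.
move=> u; apply: continuous_comp; last exact: continuous_expR.
by apply: cvgB; [exact: cvg_cst|apply: cvgMr_tmp; exact: norm_continuous].
Qed.

Let integrable_dominator : mu.-integrable setT (EFin \o dominator).
Proof.
have dom0 u : 0 <= dominator u by exact: expR_ge0.
apply/integrableP; split.
  by apply/measurable_EFinP; exact: continuous_measurable_fun.
under eq_integral do rewrite /= ger0_norm//.
rewrite ge0_symfun_integralT//; last by move=> u; rewrite /= /dominator normrN.
rewrite -set_itvcy.
pose P u : R := - 2 * expR (1 / 4 - u / 2).
have dP u : is_derive u 1 P (expR (1 / 4 - u / 2)).
  have d1 : is_derive u 1 (fun v : R => 1 / 4 - v / 2) (- (1 / 2)).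
    by apply: is_derive_eq; rewrite /GRing.scale/=; field.
  have d2 : is_derive u 1 (fun v : R => expR (1 / 4 - v / 2))
    (expR (1 / 4 - u / 2) * - (1 / 2)) by exact: is_derive1_comp.
  by apply: is_derive_eq; rewrite /GRing.scale/=; field.
have cP : continuous P.
  by move=> u; apply/differentiable_continuous/derivable1_diffP; have [] := dP u.
rewrite (@ge0_continuous_FTC2y _ _ P _ 0)//.
- by rewrite -EFinB -EFinM ltry.
- exact: continuous_subspaceT.
- rewrite /P -(mulr0 (- 2)); apply: cvgMl_tmp.
  have -> : (fun x => expR (1 / 4 - x / 2) : R) =
            (fun x => expR (1 / 4) * expR (- x)) \o (fun x => x * (1 / 2)).
    by apply/funext => u /=; rewrite -expRD; congr expR; ring.
  apply: (@cvg_comp _ _ _ _ _ _ (pinfty_nbhs R)).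
    by apply: gt0_cvgMly => //; exact: cvg_id.
  by rewrite -(mulr0 (expR (1 / 4))); apply: cvgMl_tmp; exact: cvgr_expR.
- by apply: cvg_at_right_filter; exact: cP.
- move=> u; rewrite in_itv/= andbT => u0.
  by rewrite derive1E /dominator ger0_norm ?ltW//; have [_ ->] := dP u.
Qed.

Let peak_kernel_le_dominator {x u} : 1 <= x -> peak_kernel x u <= dominator u.
Proof.
move=> x1; have x0 : 0 < x by lra.
have s0 := spread_gt0 x0.
have s1 : 1 <= spread x.
  by rewrite -[leLHS]sqrtr1 ler_sqrt; lra.
have [v0|v0] := leP (1 + 2 * u / spread x) 0.
  by rewrite peak_kernel_eq0// expR_ge0.
have [u0|/ltW u0] := leP 0 u.
  have /andP[_ /le_trans] := peak_kernel_ge0_bounds x0 u0; apply.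
  rewrite ler_expR ger0_norm// lerNl.
  apply: (@le_trans _ _ (u ^+ 2 / (1 + 2 * u))).
    by rewrite ler_pdivlMr; nra.
  rewrite ler_wpM2l ?sqr_ge0// lef_pV2 ?posrE//; last by lra.
  by rewrite lerD2l ler_pdivrMr// ler_peMr// mulr_ge0.
have /andP[_ /le_trans] := peak_kernel_le0_bounds x0 u0 v0; apply.
by rewrite ler_expR ler0_norm//; nra.
Qed.

Lemma cvg_shift_inv x c : 0 < c -> (c * (x + n%:R))^-1 @[n --> \oo] --> (0 : R).
Proof.
move=> c0.
have lim : c * (x + n%:R) @[n --> \oo] --> +oo.
  have -> : (fun n => c * (x + n%:R)) =
      (fun r => r + c * x) \o (fun r => r * c) \o (fun n => n%:R).
    by apply/funext => n /=; ring.
  apply: cvg_comp; first exact: cvgr_idn.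
  apply: cvg_comp (cvg_addrr _).
  by apply: gt0_cvgMly => //; exact: cvg_id.
by apply/gtr0_cvgV0 => //; move/cvgryPgt : lim; exact.
Qed.

Let cvg_kernel_slope x u : 0 < x ->
  (1 + 2 * u / spread (x + n%:R)) @[n --> \oo] --> (1 : R).
Proof.
move=> x0; rewrite -[X in _ --> X]addr0; apply: cvgD; first exact: cvg_cst.
rewrite -(mulr0 (2 * u)); apply: cvgMl_tmp.
have -> : (fun n : nat => (spread (x + n%:R))^-1) =
          Num.sqrt \o (fun n : nat => (2 * (x + n%:R))^-1).
  by apply/funext => n /=; rewrite sqrtrV// mulr_ge0// addr_ge0// ltW.
rewrite -(@sqrtr0 R).
apply: continuous_cvg; first exact: sqrt_continuous.
exact: cvg_shift_inv.
Qed.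

(** The two bounds on the exponent, [u^2] and [u^2 / (1 + v)], have the same limit
since [v = 2 u / spread (x + n)] tends to [0]. *)
Let cvg_peak_kernel x u : 0 < x ->
  peak_kernel (x + n%:R) u @[n --> \oo] --> gauss_fun u.
Proof.
move=> x0; have slope := cvg_kernel_slope x u x0.
have xn0 n : 0 < x + n%:R by rewrite ltr_pwDl.
have bnd : expR (- (u ^+ 2 / (1 + 2 * u / spread (x + n%:R)))) @[n --> \oo]
    --> gauss_fun u.
  apply: continuous_cvg; first exact: continuous_expR.
  apply: cvgN; rewrite -[X in _ --> X]mulr1; apply: cvgMl_tmp.
  by rewrite -[X in _ --> X]invr1; apply: cvgV => //; rewrite oner_eq0.
have [u0|/ltW u0] := leP 0 u.
  apply: squeeze_cvgr (cvg_cst _) bnd.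
  by near=> n; exact: peak_kernel_ge0_bounds.
apply: squeeze_cvgr bnd (cvg_cst _).
near=> n; apply: peak_kernel_le0_bounds => //.
by near: n; exact: (cvgr_gt _ slope).
Unshelve. all: by end_near. Qed.

Let cvg_integral_peak_kernel x : 1 <= x ->
  (\int[mu]_u (peak_kernel (x + n%:R) u)%:E @[n --> \oo] -->
   (Num.sqrt pi)%:E)%E.
Proof.
move=> x1; have x0 : 0 < x by lra.
have xn0 n : 0 < x + n%:R by rewrite ltr_pwDl.
rewrite -integralT_gauss.
have [] := @dominated_convergence _ _ R mu setT measurableT
  (fun n u => (peak_kernel (x + n%:R) u)%:E) (EFin \o gauss_fun)
  (EFin \o dominator).
- move=> n; apply/measurable_EFinP; apply: continuous_measurable_fun.
  exact: continuous_peak_kernel.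
- by apply/measurable_EFinP; exact: measurable_gauss_fun.
- apply: aeW => u _; apply: cvg_EFin; first exact: nearW.
  exact: cvg_peak_kernel.
- exact: integrable_dominator.
- apply: aeW => u n _; rewrite lee_fin ger0_norm ?peak_kernel_ge0//.
  by apply: peak_kernel_le_dominator; rewrite ler_wpDr.
by move=> _ _.
Qed.

Definition stirling_ratio x :=
  Gamma (x + 1) / (Num.sqrt (2 * pi * x) * (x / expR 1) `^ x).

Lemma gamma_density_peak {x} : 0 < x -> gamma_density x x = (x / expR 1) `^ x.
Proof.
move=> x0; rewrite /gamma_density ppowR_pos ?ltW//.
rewrite /powR !gt_eqF ?divr_gt0 ?expR_gt0// -expRD; congr expR.
by rewrite ln_div ?posrE ?expR_gt0// expRK mulrBr mulr1.
Qed.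

Let stirling_ratioE {x} : 0 < x -> stirling_ratio x =
  fine (\int[mu]_u (peak_kernel x u)%:E)%E / Num.sqrt pi.
Proof.
move=> x0; have s0 := spread_gt0 x0; have p0 := gamma_density_peak_gt0 x0.
have pi0 : 0 < Num.sqrt (pi : R) by rewrite sqrtr_gt0 pi_gt0.
rewrite /stirling_ratio GammaET// integral_gamma_density_kernel//.
rewrite fine_mulEFin ?(mulr_gt0 s0 p0)// -(gamma_density_peak x0).
have -> : Num.sqrt (2 * pi * x) = Num.sqrt pi * spread x.
  by rewrite /spread -sqrtrM ?pi_ge0//; congr Num.sqrt; ring.
by field; rewrite !gt_eqF.
Qed.

(** The formula of Stirling along [x, x + 1, x + 2, ...]. *)
Lemma cvg_stirling_ratio {x} : 1 <= x ->
  stirling_ratio (x + n%:R) @[n --> \oo] --> (1 : R).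
Proof.
move=> x1; have pi0 : 0 < Num.sqrt (pi : R) by rewrite sqrtr_gt0 pi_gt0.
have -> : (fun n => stirling_ratio (x + n%:R)) = (fun n =>
    fine (\int[mu]_u (peak_kernel (x + n%:R) u)%:E)%E / Num.sqrt pi).
  by apply/funext => n; rewrite stirling_ratioE// ltr_pwDl//; lra.
have lim := fine_cvg (cvg_integral_peak_kernel x x1).
rewrite -[X in _ --> X](divff (lt0r_neq0 pi0)).
apply: cvgMr_tmp; exact: lim.
Qed.

End Stirling.

(** * Monotonicity of the remainder *)

Section Remainder.
Local Open Scope classical_set_scope.
Local Open Scope ring_scope.
Context {R : realType}.
Implicit Types (x y c l : R) (n : nat) (u : R^nat).

Lemma decreasing_cvg_lt {u l} :
  (forall n, u n.+1 < u n) -> u @ \oo --> l -> l < u 0%N.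
Proof.
move=> udec ul; apply: le_lt_trans (udec 0%N).
have noninc : nonincreasing_seq u by apply/nonincreasing_seqP => n; exact: ltW.
by have := nonincreasing_cvgn_ge noninc (cvgP l ul) 1; rewrite (cvg_lim _ ul).
Qed.

Lemma nonincreasing_cvg_le {u l} :
  (forall n, u n.+1 <= u n) -> u @ \oo --> l -> l <= u 0%N.
Proof.
move=> /nonincreasing_seqP noninc ul.
by have := nonincreasing_cvgn_ge noninc (cvgP l ul) 0; rewrite (cvg_lim _ ul).
Qed.

(** The successive differences [u m - u m.+1] strictly decrease to [0], so they are
positive; thus [u] itself strictly decreases to [0]. *)
Lemma strictly_convex_seq_gt0 {u} :
  (forall n, 0 < u n - 2 * u n.+1 + u n.+2) -> u @ \oo --> (0 : R) ->
  0 < u 0%N.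
Proof.
move=> ucvx u0.
have uS m : (fun n => u (n + m)%N) @ \oo --> (0 : R) by rewrite cvg_shiftn.
have step m : 0 < u m - u m.+1.
  have d0 : (fun n => u (n + m)%N - u (n + m.+1)%N) @ \oo --> (0 : R).
    by rewrite -[X in _ --> X](subr0 0); apply: cvgB.
  have := decreasing_cvg_lt _ d0; rewrite !add0n; apply => n.
  by rewrite !addSn !addnS; have := ucvx (n + m)%N; lra.
by apply: decreasing_cvg_lt u0 => n; rewrite -subr_gt0.
Qed.

Let denominator_gt0 {x} : 0 < x ->
  0 < Num.sqrt (2 * pi * x) * (x / expR 1) `^ x.
Proof.
move=> x0; apply: mulr_gt0; last by rewrite powR_gt0// divr_gt0 ?expR_gt0.
by rewrite sqrtr_gt0 !mulr_gt0 ?pi_gt0.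
Qed.

Let Gamma_gt0_shift n {x} : 0 < x -> 0 < Gamma (x + n%:R + 1) ->
  0 < Gamma (x + 1).
Proof.
move=> x0; elim: n => [|n IHn]; first by rewrite addr0.
have xn0 : 0 < x + n%:R by rewrite ltr_pwDl.
by rewrite -natr1 addrA GammaS// pmulr_rgt0//; lra.
Qed.

(** The formula of Stirling makes [Gamma (x + n + 1)] positive for large [n], and
the functional equation carries the sign back to [Gamma (x + 1)]. *)
Lemma Gamma_gt0 {x} : 0 < x -> 0 < Gamma (x + 1).
Proof.
move=> x0; have x11 : 1 <= x + 1 by lra.
have [n _ /(_ n (leqnn n))] := cvgr_gt _ (cvg_stirling_ratio x11) _ ltr01.
have -> : x + 1 + n%:R = x + n.+1%:R by rewrite -addrA nat1r.
rewrite /stirling_ratio.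
have xn0 : 0 < x + n.+1%:R by rewrite ltr_pwDl.
rewrite pmulr_lgt0 ?invr_gt0 ?denominator_gt0//.
exact: Gamma_gt0_shift.
Qed.

(** The function of Binet, that is, the remainder in the logarithmic form of the
formula of Stirling. *)
Definition binet x := ln (stirling_ratio x).

Lemma binetE {x} : 0 < x ->
  binet x = ln (Gamma (x + 1)) - (ln (2 * pi) + ln x) / 2 - x * (ln x - 1).
Proof.
move=> x0; have tp0 : 0 < 2 * pi :> R by rewrite mulr_gt0 ?pi_gt0.
have xe0 : 0 < x / expR 1 by rewrite divr_gt0 ?expR_gt0.
have tpx0 := mulr_gt0 tp0 x0.
rewrite /binet /stirling_ratio ln_div ?posrE ?Gamma_gt0 ?denominator_gt0//.
move: tp0 tpx0; set c := 2 * pi => tp0 tpx0.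
rewrite lnM ?posrE ?powR_gt0 ?sqrtr_gt0// -powR12_sqrt ?(ltW tpx0)//.
by rewrite !ln_powR lnM ?posrE// ln_div ?posrE ?expR_gt0// expRK; field.
Qed.

Lemma binet_diff {x} : 0 < x -> binet x - binet (x + 1) = gudermann x.
Proof.
move=> x0; have x10 : 0 < x + 1 by rewrite addr_gt0.
rewrite !binetE// GammaS// [ln (_ * Gamma _)]lnM ?posrE ?Gamma_gt0//.
rewrite /gudermann.
by field.
Qed.

Lemma cvg_binet {x} : 0 < x -> binet (x + n%:R) @[n --> \oo] --> (0 : R).
Proof.
move=> x0; rewrite -[X in _ --> X](@ln1 R) -cvg_shiftS.
have -> : (fun n => binet (x + n.+1%:R)) =
          (@ln R) \o (fun n => stirling_ratio (x + 1 + n%:R)).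
  by apply/funext => n /=; rewrite -addrA nat1r.
apply: (@continuous_cvg _ _ _ _ _ _ (@ln R) 1).
  exact: (continuous_ln ltr01).
by apply: cvg_stirling_ratio; lra.
Qed.

(** By [gudermann_bounds] and [binet_diff], subtracting either bound from [binet]
leaves a function that is monotone along [x, x + 1, x + 2, ...] and tends to [0],
which determines its sign at [x]. *)
Lemma binet_bounds {x} : 0 < x ->
  (12 * (x + 1 / 2))^-1 <= binet x <= (12 * x)^-1.
Proof.
move=> x0; have xn0 n : 0 < x + n%:R by rewrite ltr_pwDl.
have xS n : x + n.+1%:R = x + n%:R + 1 by rewrite -addrA natr1.
apply/andP; split.
  pose u n := binet (x + n%:R) - (12 * (x + 1 / 2 + n%:R))^-1.
  have u0 : u @ \oo --> (0 : R).
    rewrite -[X in _ --> X](subr0 0).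
    by apply: cvgB; [exact: cvg_binet|exact: cvg_shift_inv].
  suff : 0 <= u 0%N by rewrite /u !addr0 subr_ge0.
  apply: nonincreasing_cvg_le u0 => n; rewrite /u !xS.
  have /andP[+ _] := gudermann_bounds (xn0 n); rewrite -(binet_diff (xn0 n)).
  have -> : x + 1 / 2 + n.+1%:R = x + n%:R + 3 / 2 by rewrite -natr1; field.
  by rewrite [x + 1 / 2 + _]addrAC; lra.
pose u n := (12 * (x + n%:R))^-1 - binet (x + n%:R).
have u0 : u @ \oo --> (0 : R).
  rewrite -[X in _ --> X](subr0 0).
  by apply: cvgB; [exact: cvg_shift_inv|exact: cvg_binet].
suff : 0 <= u 0%N by rewrite /u !addr0 subr_ge0.
apply: nonincreasing_cvg_le u0 => n; rewrite /u !xS.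
by have /andP[_] := gudermann_bounds (xn0 n); rewrite -(binet_diff (xn0 n)); lra.
Qed.

Lemma sigmaE x : sigma x = 12 * x * binet x.
Proof. by []. Qed.

Lemma cvg_sigma {x} : 0 < x -> sigma (x + n%:R) @[n --> \oo] --> (1 : R).
Proof.
move=> x0.
have lo : 1 - (2 * (x + 1 / 2 + n%:R))^-1 @[n --> \oo] --> (1 : R).
  rewrite -[X in _ --> X](subr0 1); apply: cvgB; first exact: cvg_cst.
  exact: cvg_shift_inv.
apply: squeeze_cvgr lo (cvg_cst _); near=> n.
have xn0 : 0 < x + n%:R by rewrite ltr_pwDl.
rewrite [x + 1 / 2 + _]addrAC; set z := x + n%:R in xn0 *.
have /andP[lo up] := binet_bounds xn0.
have c0 : 0 <= 12 * z by rewrite mulr_ge0// ltW.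
rewrite sigmaE; apply/andP; split.
  apply: le_trans (ler_wpM2l c0 lo).
  rewrite le_eqVlt; apply/predU1P; left; field.
  by rewrite gt_eqF//; lra.
apply: le_trans (ler_wpM2l c0 up) _.
by rewrite divff// gt_eqF// mulr_gt0.
Unshelve. all: by end_near. Qed.

(** Since [binet (x + 1)] and [binet (x + 2)] differ from [binet x] by values of
[gudermann], and [x - 2 (x + 1) + (x + 2) = 0], the coefficient of [binet x] is
zero. *)
Lemma sigma_second_diff {x} : 0 < x ->
  sigma x - 2 * sigma (x + 1) + sigma (x + 2) =
  12 * (x * gudermann x - (x + 2) * gudermann (x + 1)).
Proof.
move=> x0; have x10 : 0 < x + 1 by rewrite addr_gt0.
rewrite -!binet_diff// !sigmaE.
have -> : x + 1 + 1 = x + 2 by ring.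
ring.
Qed.

End Remainder.

Theorem theorem2p1 (R : realType) :
  {in `]0, +oo[ &, {homo @sigma R : x y / x < y}}.
Proof.
move=> x y; rewrite !in_itv/= !andbT => x0 y0 xy.
pose D n : R := sigma (y + n%:R) - sigma (x + n%:R).
suff : 0 < D 0%N by rewrite /D !addr0 subr_gt0.
apply: strictly_convex_seq_gt0 => [n|]; last first.
  by rewrite -(subrr (1 : R)); apply: cvgB; exact: cvg_sigma.
have xn0 : 0 < x + n%:R by rewrite ltr_pwDl.
have yn0 : 0 < y + n%:R by rewrite ltr_pwDl.
have xyn : x + n%:R < y + n%:R by rewrite ltrD2r.
have S1 z : z + n.+1%:R = z + n%:R + 1 :> R by rewrite -addrA natr1.
have S2 z : z + n.+2%:R = z + n%:R + 2 :> R by rewrite -addrA -natrD addn2.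
have := gudermann_diff_lt xn0 xyn.
have := sigma_second_diff xn0; have := sigma_second_diff yn0.
rewrite /D !S1 !S2; lra.
Qed.
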